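(* For Lebesgue almost all $x\in(0,1)$, $$\liminf_{n\to\infty}\frac{\log R_n(x)-\log n}{\log\log n}=-\infty\quad\text{and}\quad\liminf_{n\to\infty}\frac{\log M_n(x)-\log n}{\log\log n}=0.$$
   Context: Signed Engel expansion: define $T\colon[0,1)\to[0,1)$ by: for $k\in\mathbb{N}$, $Tx=\lceil 1/x\rceil x-1$ if $x\in(\frac{1}{2k},\frac{1}{2k-1})$; $Tx=1-\lfloor 1/x\rfloor x$ if $x\in(\frac{1}{2k+1},\frac{1}{2k})$; $Tx=0$ if $x\in\{0\}\cup\{1/n\colon n\ge 2\}$. For $x\in(0,1)$, $d_1(x)=\lceil 1/x\rceil$ if $x\in[\frac{1}{2k},\frac{1}{2k-1})$ for some $k\in\mathbb{N}$, and $d_1(x)=\lfloor 1/x\rfloor$ if $x\in[\frac{1}{2k+1},\frac{1}{2k})$ for some $k\in\mathbb{N}$; $d_{n+1}(x)=d_1(T^nx)$. For irrational $x\in(0,1)$, $R_1(x)=d_1(x)$, $R_n(x)=d_n(x)/d_{n-1}(x)$ for $n\ge2$, and $M_n(x)=\max\{R_k(x)\colon 1\le k\le n\}$. *)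

(* Defs.v *)
From HB Require Import structures.
From mathcomp Require Import all_boot all_order all_algebra.
From mathcomp Require Import all_classical all_reals all_analysis.
Set Implicit Arguments. Unset Strict Implicit. Unset Printing Implicit Defensive.
Import Order.TTheory GRing.Theory Num.Theory.
Local Open Scope ring_scope.

Section SignedEngel.
Variable R : realType.
Implicit Types x : R.

Definition sengel_T x : R :=
  if `[< exists k : nat, (0 < k)%N /\ ((2 * k)%:R)^-1 < x /\ x < ((2 * k - 1)%:R)^-1 >]
  then (Num.ceil x^-1)%:~R * x - 1
  else if `[< exists k : nat, (0 < k)%N /\ ((2 * k + 1)%:R)^-1 < x /\ x < ((2 * k)%:R)^-1 >]
  then 1 - (Num.floor x^-1)%:~R * x
  else 0.

Definition sengel_d1 x : R :=
  if `[< exists k : nat, (0 < k)%N /\ ((2 * k)%:R)^-1 <= x /\ x < ((2 * k - 1)%:R)^-1 >]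
  then (Num.ceil x^-1)%:~R
  else (Num.floor x^-1)%:~R.

(* d_n x for n >= 1: d_1 (T^(n-1) x);  (d_0 is an unused junk value) *)
Definition sengel_d (n : nat) x : R := sengel_d1 (iter n.-1 sengel_T x).

Definition sengel_R (n : nat) x : R :=
  if (n <= 1)%N then sengel_d 1 x else sengel_d n x / sengel_d n.-1 x.

Definition sengel_M (n : nat) x : R :=
  \big[Order.max/sengel_R 1 x]_(1 <= k < n.+1) sengel_R k x.


End SignedEngel.

(* Main.v *)
Require Import Defs.
From HB Require Import structures.
From mathcomp Require Import all_boot all_order all_algebra.
From mathcomp Require Import all_classical all_reals all_analysis.
From mathcomp Require Import ring lra zify.
Set Implicit Arguments. Unset Strict Implicit. Unset Printing Implicit Defensive.
Import Order.TTheory GRing.Theory Num.Theory.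
Local Open Scope ring_scope.

(** For irrational x in (0,1) the first digit is 2k with 1/(2k+1) < x < 1/(2k-1)
    and T x = |2kx - 1|.  The two branches of T with digit 2k are affine onto
    (0,1/m) with m = 2k-1 and m = 2k+1, so given the past, T^n x is uniform on such
    an interval and the next ratio exceeds t with probability of order 1/t,
    essentially independently of the past.  By Borel-Cantelli, almost surely and for
    all large j:
    - R_n <= 2^j and M_n <= 2 n 2^j along n = 2^(2^(j^2)), for which
      log log n is of order j^2: this gives the first limit and the upper bound of
      the second;
    - M_n >= 2^j for n >= 2^j L_j with L_j of order log j, because all the first n
      ratios are at most 2^j with probability at most (1 - 1/(2^(j+1) + 1))^n: this
      gives the lower bound of the second limit.
    Probabilities are replaced by total lengths of finite interval covers. *)

(** * Finite interval covers and their total length *)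

Section Covering.
Variable R : realType.
Implicit Types (A B : set R) (r c : R) (s : seq (R * R)).

(** Finite covers ask for no measurability of [A] and pull back along an affine map by moving
    endpoints; [covered_measurable] turns them into measurable sets. *)
Definition covered A r := exists s,
  [/\ forall x, A x -> has (fun p => p.1 < x < p.2) s,
      all (fun p => p.1 <= p.2) s & \sum_(p <- s) (p.2 - p.1) <= r].

Lemma covered_le {A B r1 r2} :
  (forall x, A x -> B x) -> r1 <= r2 -> covered B r1 -> covered A r2.
Proof.
move=> AB r12 [s [sB sle sr]]; exists s; split => //; first by move=> x /AB/sB.
exact: le_trans r12.
Qed.

Lemma covered_itv {a b : R} : a <= b -> covered (fun x => a < x < b) (b - a).
Proof.
by move=> ab; exists [:: (a, b)]; split => [x /=| /= |]; rewrite ?orbF ?ab ?big_seq1.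
Qed.

Lemma covered0 r : 0 <= r -> covered (fun=> False) r.
Proof. by move=> r0; exists [::]; split => //; rewrite big_nil. Qed.

Lemma coveredU {A B r1 r2} : covered A r1 -> covered B r2 ->
  covered (fun x => A x \/ B x) (r1 + r2).
Proof.
move=> [s [sA sle sr]] [s' [sB sle' sr']]; exists (s ++ s'); split.
- by move=> x [/sA|/sB]; rewrite has_cat => ->; rewrite ?orbT.
- by rewrite all_cat sle.
- by rewrite big_cat/= lerD.
Qed.

Lemma covered_bigU n (A : nat -> set R) r : (forall i, (i < n)%N -> covered (A i) r) ->
  covered (fun x => exists2 i, (i < n)%N & A i x) (r *+ n).
Proof.
elim: n => [_|n IH cA]; first by apply: covered_le (covered0 _) => // x [].
rewrite mulrSr.
apply: covered_le (coveredU (IH (fun i ni => cA i (ltnW ni))) (cA n (ltnSn n))) => //.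
move=> x [i]; rewrite ltnS leq_eqVlt => /orP[/eqP ->|ni] Ax; first by right.
by left; exists i.
Qed.

Lemma covered_affineD A r c : 0 < c -> covered A r ->
  covered (fun x => A (c * x - 1)) (r / c).
Proof.
move=> c0 [s [sA sle sr]]; exists [seq ((p.1 + 1) / c, (p.2 + 1) / c) | p <- s]; split.
- move=> x /sA; rewrite has_map => /hasP[p ps /andP[h1 h2]]; apply/hasP; exists p => //=.
  by rewrite ltr_pdivrMr// ltr_pdivlMr// mulrC -ltrBrDr h1 -ltrBlDr h2.
- rewrite all_map; apply: sub_all sle => p /= ple.
  by rewrite ler_pM2r ?invr_gt0// lerD2r.
- rewrite big_map/= ler_pdivlMr// mulr_suml; apply: le_trans sr.
  by apply: ler_sum => p _; rewrite -mulrBl divfK ?gt_eqF//; lra.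
Qed.

Lemma covered_affineB A r c : 0 < c -> covered A r ->
  covered (fun x => A (1 - c * x)) (r / c).
Proof.
move=> c0 [s [sA sle sr]]; exists [seq ((1 - p.2) / c, (1 - p.1) / c) | p <- s]; split.
- move=> x /sA; rewrite has_map => /hasP[p ps /andP[h1 h2]]; apply/hasP; exists p => //=.
  by rewrite ltr_pdivrMr// ltr_pdivlMr// mulrC; apply/andP; split; lra.
- rewrite all_map; apply: sub_all sle => p /= ple.
  by rewrite ler_pM2r ?invr_gt0// lerB.
- rewrite big_map/= ler_pdivlMr// mulr_suml; apply: le_trans sr.
  by apply: ler_sum => p _; rewrite -mulrBl divfK ?gt_eqF//; lra.
Qed.

End Covering.

(** * The two affine branches over a digit, and uniform length estimates *)

Section Branches.
Variable R : realType.
Implicit Types (x y delta : R) (k m n a K t : nat) (A : nat -> set R).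

(* The digit d_1 x is [2 k]; the last condition excludes the endpoint 1/(2k), where T vanishes. *)
Definition has_digit k x :=
  [/\ (0 < k)%N, (k.*2.+1%:R)^-1 < x, x < (k.*2.-1%:R)^-1 & k.*2%:R * x != 1].

(** The cutoff [K] serves twice: as the largest half-digit that keeps a ratio small, and as a
    truncation that leaves finitely many half-digits to cover. *)
Definition hits_next (A : nat -> set R) K x :=
  exists k, [/\ (k <= K)%N, has_digit k x & A k `|k.*2%:R * x - 1|].

(* In every interval where an orbit point with previous digit [2 k] can lie, [A k] has relative
   length at most [delta]. *)
Definition uniform_bound A delta :=
  forall k m, (0 < k)%N -> m = k.*2.-1 \/ m = k.*2.+1 ->
    covered (fun x => A k x /\ 0 < x < (m%:R)^-1) (delta / m%:R).

(** On the two sides of 1/(2k), |2kx - 1| is affine with slope 2k or -2k, and its values lie in (0,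
    1/(2k-1)) and (0, 1/(2k+1)). The preimages have total length (delta/2k)(1/(2k-1) + 1/(2k+1)),
    which equals delta(1/(2k-1) - 1/(2k+1)). *)
Lemma covered_branch A k delta : (0 < k)%N -> uniform_bound A delta ->
  covered (fun x => has_digit k x /\ A k `|k.*2%:R * x - 1|)
    (delta * ((k.*2.-1%:R)^-1 - (k.*2.+1%:R)^-1)).
Proof.
move=> k0 UA.
have c0 : 0 < k.*2%:R :> R by rewrite ltr0n double_gt0.
have m1 : 0 < k.*2.-1%:R :> R by rewrite ltr0n; lia.
have m3 : 0 < k.*2.+1%:R :> R by rewrite ltr0n.
have e1 : k.*2.-1%:R = k.*2%:R - 1 :> R.
  by rewrite -subn1 natrB//; lia.
have e3 : k.*2.+1%:R = k.*2%:R + 1 :> R by rewrite -natr1.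
have h1 := covered_affineD c0 (UA k _ k0 (or_introl erefl)).
have h3 := covered_affineB c0 (UA k _ k0 (or_intror erefl)).
apply: covered_le (coveredU h1 h3); last first.
  rewrite le_eqVlt; apply/orP; left; apply/eqP; rewrite e1 e3.
  rewrite e1 in m1; rewrite e3 in m3; field.
  by rewrite !gt_eqF.
move=> x [[_ xl xu xc]].
have x0 : 0 < x by apply: lt_trans xl; rewrite invr_gt0.
have [h|h|h] := ltgtP (k.*2%:R * x) 1; last by rewrite h eqxx in xc.
- rewrite ltr0_norm ?subr_lt0// opprB => Ak; right; split=> //.
  rewrite /= subr_gt0 h/=.
  move: xl; rewrite -(ltr_pM2l m3) divff ?gt_eqF// => xl.
  rewrite -(ltr_pM2l m3) divff ?gt_eqF//; rewrite e3 in xl m3 *; nra.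
- rewrite gtr0_norm ?subr_gt0// => Ak; left; split=> //.
  rewrite /= ?subr_gt0 h/=.
  move: xu; rewrite -(ltr_pM2l m1) divff ?gt_eqF// => xu.
  rewrite -(ltr_pM2l m1) divff ?gt_eqF//; rewrite e1 in xu m1 *; nra.
Qed.

(** A point below 1/(2a+1) has half-digit above a, so only a+1, ..., K occur; the intervals of
    consecutive half-digits abut and their lengths telescope. *)
Lemma covered_hits_next A a K delta : 0 <= delta -> (a <= K)%N -> uniform_bound A delta ->
  covered (fun x => hits_next A K x /\ 0 < x < (a.*2.+1%:R)^-1)
    (delta * ((a.*2.+1%:R)^-1 - (K.*2.+1%:R)^-1)).
Proof.
move=> d0 aK UA; rewrite -(subnKC aK); elim: (K - a)%N => [|n IH].
  rewrite addn0 subrr mulr0; apply: covered_le (covered0 (lexx 0)) => // x.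
  move=> [[k [ka [k0 xl _ _] _]]] /andP[_ /(lt_trans xl)].
  by rewrite ltf_pV2 ?posrE// ltr_nat; lia.
have h := coveredU IH (covered_branch (ltn0Sn (a + n)) UA). apply: covered_le h; last first.
  by rewrite addnS doubleS/= -mulrDr addrA subrK.
move=> x [[k [kK dk Ak]] xa].
move: kK; rewrite addnS leq_eqVlt => /orP[/eqP kE|kK]; last by left; split => //; exists k.
by right; rewrite -kE.
Qed.

(* [small_ratios t n k x]: starting from the previous half-digit [k], the next [n] ratios are all
   at most [t]; [large_ratio t n k x]: the ratio of index [n], counted from 0, exceeds [t]. *)
Definition small_ratios t : nat -> nat -> R -> Prop :=
  fix E n k x := if n is n'.+1 then hits_next (E n') (t * k) x else True.

Definition large_ratio t : nat -> nat -> R -> Prop :=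
  fix F n k x := if n is n'.+1 then exists K, hits_next (F n') K x
                 else exists k', (t * k < k')%N /\ has_digit k' x.

(** Treats both branches at once: up to countably many points, (0, 1/m) is the union of the
    intervals of the half-digits above a. *)
Lemma odd_pm k m : (0 < k)%N -> m = k.*2.-1 \/ m = k.*2.+1 ->
  exists2 a, m = a.*2.+1 & (a <= k <= a.+1)%N.
Proof. by move=> k0 [->|->]; [exists k.-1 | exists k]; lia. Qed.

(** Half-digits above tk occupy a fraction m/(2tk+1) of (0, 1/m). This is at least 1/(2t+1), since
    2tk+1 <= m(2t+1), so each step contributes a factor at most 1 - 1/(2t+1). *)
Lemma uniform_small_ratios t n : (0 < t)%N ->
  uniform_bound (small_ratios t n) ((1 - (t.*2.+1%:R)^-1) ^+ n).
Proof.
move=> t0; elim: n => [|n IH] k m k0 mE; have [a ma ak] := odd_pm k0 mE.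
  have : 0 <= (m%:R)^-1 :> R by rewrite invr_ge0.
  move/covered_itv; apply: covered_le; last by rewrite expr0 subr0 mul1r.
  by move=> x [].
have aK : (a <= t * k)%N by nia.
have t1 : 0 <= 1 - (t.*2.+1%:R)^-1 :> R.
  by rewrite subr_ge0 invf_le1 ?ler1n.
apply: covered_le (covered_hits_next (exprn_ge0 n t1) aK IH).
  by rewrite ma.
rewrite -ma exprSr -mulrA; apply: ler_wpM2l; first exact: exprn_ge0.
have m0 : 0 < m%:R :> R by rewrite ltr0n ma.
rewrite mulrBl mul1r lerB// -invfM lef_pV2 ?posrE ?mulr_gt0 ?ltr0n//.
  by rewrite -natrM ler_nat; nia.
by rewrite ma.
Qed.

(** For n = 0 the point is below 1/(2tk+1), a fraction m/(2tk+1) <= 3/(2t) of (0, 1/m). In the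
    induction step the next digit is arbitrary: half-digits up to [K] are covered by the induction
    hypothesis for some d' < delta, all others by the single interval (0, 1/(2K+1)), paid for by
    delta - d'. The strict hypothesis provides this slack. *)
Lemma uniform_large_ratio t n delta : (0 < t)%N -> 3 / t.*2%:R < delta ->
  uniform_bound (large_ratio t n) delta.
Proof.
move=> t0; have tR : 0 < t.*2%:R :> R by rewrite ltr0n double_gt0.
elim: n delta => [|n IH] delta td k m k0 mE; have [a ma ak] := odd_pm k0 mE;
    have m0 : 0 < m%:R :> R by rewrite ltr0n ma.
  have : 0 <= ((t * k).*2.+1%:R)^-1 :> R by rewrite invr_ge0.
  move/covered_itv; apply: covered_le.
    move=> x [[k' [kk' [_ _ xk' _]]] /andP[-> _]]; apply: (lt_le_trans xk').
    by rewrite lef_pV2 ?posrE ?ltr0n ?ler_nat//; lia.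
  rewrite subr0 ler_pdivlMr// mulrC; apply: le_trans (ltW td).
  rewrite ler_pdivlMr// mulrAC ler_pdivrMr ?ltr0n// -!natrM ler_nat; nia.
pose d' : R := (delta + 3 / t.*2%:R) / 2.
have d'd : d' < delta by rewrite /d'; lra.
have d'0 : 0 <= d' by rewrite /d'; have : 0 <= 3 / t.*2%:R :> R by []; lra.
have d't : 3 / t.*2%:R < d' by rewrite /d'; lra.
pose e := (delta - d') / m%:R.
have e0 : 0 < e by rewrite divr_gt0 ?subr_gt0.
pose K := (a + (Num.truncn e^-1).+1)%N.
have Ke : (K.*2.+1%:R)^-1 <= e.
  rewrite -[leRHS]invrK lef_pV2 ?posrE ?invr_gt0//.
  by apply: (le_trans (ltW (truncnS_gt _))); rewrite ler_nat /K; move: (Num.truncn _) => u; lia.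
have aK : (a <= K)%N by rewrite /K leq_addr.
have K0 : 0 <= (K.*2.+1%:R)^-1 :> R by rewrite invr_ge0.
apply: covered_le (coveredU (covered_hits_next d'0 aK (IH d' d't)) (covered_itv K0)).
  move=> x [[K' [k' [k'K' dk' Fk']]] xm].
  have [k'K|Kk'] := leqP k' K; first by left; rewrite -ma; split => //; exists k'.
  right; case/andP: xm => -> _ /=; case: dk' => _ _ xk' _; apply: (lt_le_trans xk').
  by rewrite lef_pV2 ?posrE ?ltr0n ?ler_nat//; lia.
rewrite -ma subr0; have -> : delta / m%:R = d' / m%:R + e by rewrite /e; field; rewrite gt_eqF.
by rewrite mulrBr -addrA lerD2l (le_trans _ Ke)// gerDr oppr_le0 mulr_ge0.
Qed.

End Branches.

(** * Half-digits along an irrational orbit *)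

Section Orbits.
Variable R : realType.
Implicit Types (x y z : R) (k n a t : nat).

Lemma irrational_mulnBn y a b : irrational y -> (0 < a)%N -> irrational (a%:R * y - b%:R).
Proof.
move=> yirr a0 [q _ qE]; apply: yirr; exists ((q + b%:R) / a%:R) => //.
rewrite fmorph_div/= rmorphD/= !ratr_nat qE subrK mulrC mulKf//.
by rewrite pnatr_eq0 -lt0n.
Qed.

Lemma irrationalN y : irrational y -> irrational (- y).
Proof. by move=> yirr [q _ qE]; apply: yirr; exists (- q) => //; rewrite // rmorphN/= qE opprK. Qed.

Lemma irrational_norm y : irrational y -> irrational `|y|.
Proof. by move=> yi; have [] := ger0P y => // _; exact: irrationalN. Qed.

Lemma irrational_inv_neq y n : irrational y -> y^-1 != n%:R.
Proof.
move=> yirr; apply/eqP => yn; apply: yirr; exists (n%:R^-1) => //.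
by rewrite fmorphV/= ratr_nat -yn invrK.
Qed.

Lemma sengel_digit y : 0 < y < 1 -> irrational y ->
  exists k, [/\ has_digit k y, sengel_d1 y = k.*2%:R & sengel_T y = `|k.*2%:R * y - 1|].
Proof.
move=> /andP[y0 y1] yirr.
have z0 : 0 < y^-1 by rewrite invr_gt0.
have z1 : 1 < y^-1 by rewrite invf_gt1.
have zE n : y^-1 != n%:R := irrational_inv_neq n yirr.
(* 2k is the even integer with 2k-1 <= 1/y < 2k+1; irrationality excludes equality of 1/y with 2k-1
   and with 2k. *)
pose k := Num.truncn ((y^-1 + 1) / 2).
have /andP[kl ku] : k%:R <= (y^-1 + 1) / 2 < k.+1%:R by apply: truncn_itv; lra.
have k0 : (0 < k)%N by rewrite truncn_gt0; lra.
clearbody k.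
have zl : (2 * k - 1)%N%:R < y^-1.
  rewrite lt_neqAle eq_sym zE/= natrB; last by clear -k0; lia.
  rewrite natrM; lra.
have zu : y^-1 < (2 * k + 1)%N%:R.
  by rewrite natrD natrM; move: ku; rewrite -[k.+1%:R]natr1; lra.
have ivl n : (0 < n)%N -> (n%:R^-1 < y) = (y^-1 < n%:R).
  by move=> n0; rewrite -[in LHS](invrK y) ltf_pV2 ?posrE ?ltr0n.
have ivg n : (0 < n)%N -> (y < n%:R^-1) = (n%:R < y^-1).
  by move=> n0; rewrite -[in LHS](invrK y) ltf_pV2 ?posrE ?ltr0n.
have e2 : k.*2 = (2 * k)%N by rewrite mul2n.
have dk : has_digit k y.
  split => //.
  - by rewrite ivl// -addn1 e2.
  - by rewrite ivg; rewrite -?subn1 ?e2; last by clear -k0; lia.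
  - apply/eqP => h; case/eqP: (zE k.*2); apply: (mulIf (lt0r_neq0 y0)).
    by rewrite h mulVf ?gt_eqF.
have [zk|kz|] := ltgtP y^-1 (2 * k)%N%:R; last by move/eqP; rewrite (negbTE (zE _)).
- have ck : Num.ceil y^-1 = k.*2%:Z.
    apply: ceil_def; rewrite -pmulrn e2 ltW// andbT.
    by rewrite intrB -pmulrn; rewrite natrB in zl; last by clear -k0; lia.
  have k2 : (2 * k)%:R^-1 < y by rewrite ivl//; clear -k0; lia.
  have k3 : y < (2 * k - 1)%N%:R^-1 by rewrite ivg//; clear -k0; lia.
  exists k; split => //.
  - rewrite /sengel_d1 asboolT ?ck//; exists k; split => //; split => //; exact: ltW.
  - rewrite /sengel_T asboolT ?ck; last by exists k.
    by rewrite -pmulrn gtr0_norm// subr_gt0 -ltr_pdivrMr// mul1r e2.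
- have fk : Num.floor y^-1 = k.*2%:Z.
    apply: floor_def; rewrite intrD -!pmulrn e2 ltW//.
    by rewrite natrD in zu.
  have k2 : y < (2 * k)%:R^-1 by rewrite ivg//; clear -k0; lia.
  have k3 : (2 * k + 1)%N%:R^-1 < y by rewrite ivl//; clear -k0; lia.
  (* Rules out the first clause of both definitions: 1/y lies between 2k and 2k+1, hence in no
     interval (2k'-1, 2k']. *)
  have nk k' : (0 < k')%N -> (2 * k')%:R^-1 <= y -> y < (2 * k' - 1)%N%:R^-1 -> False.
    move=> k'0 h1 h2.
    have := lt_trans k3 h2; have := le_lt_trans h1 k2.
    have k'1 : (0 < 2 * k' - 1)%N by clear -k'0; lia.
    rewrite !ltf_pV2 ?posrE ?ltr0n ?muln_gt0 ?addn1// !ltr_nat.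
    by clear -k'0; lia.
  exists k; split => //.
  - by rewrite /sengel_d1 asboolF ?fk// => -[k' [? [? ?]]]; exact: (nk k').
  - rewrite /sengel_T asboolF; last by move=> -[k' [? [/ltW ? ?]]]; exact: (nk k').
    rewrite asboolT ?fk; last by exists k.
    rewrite -pmulrn ltr0_norm ?opprB// subr_lt0 -ltr_pdivlMr// mul1r e2//.
Qed.

Lemma has_digit_norm k y : irrational y -> has_digit k y ->
  0 < `|k.*2%:R * y - 1| < 1 /\ irrational `|k.*2%:R * y - 1|.
Proof.
move=> yirr [k0 yl yu yk]; split; last first.
  by apply: irrational_norm; apply: (@irrational_mulnBn y k.*2 1) => //; rewrite double_gt0.
rewrite normr_gt0 subr_eq0 yk/= ltr_norml.
have m1 : 0 < k.*2.-1%:R :> R by rewrite ltr0n; lia.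
have c0 : 0 < k.*2%:R :> R by rewrite ltr0n; lia.
have y0 : 0 < y by apply: lt_trans yl; rewrite invr_gt0.
apply/andP; split; first by have := mulr_gt0 c0 y0; lra.
rewrite ltrBlDr; apply: (lt_le_trans (_ : _ < k.*2%:R / k.*2.-1%:R)); first by rewrite ltr_pM2l.
by rewrite ler_pdivrMr// -[1 + 1]/(2%:R) -natrM ler_nat; clear -k0; lia.
Qed.

Definition orbit_digits (kappa : nat -> nat) x := forall n,
  [/\ has_digit (kappa n) (iter n (@sengel_T R) x),
      sengel_d n.+1 x = (kappa n).*2%:R &
      iter n.+1 (@sengel_T R) x = `|(kappa n).*2%:R * iter n (@sengel_T R) x - 1| ].

Lemma orbit_digits_exists x : 0 < x < 1 -> irrational x -> exists kappa, orbit_digits kappa x.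
Proof.
move=> x01 xirr.
have orb n : 0 < iter n (@sengel_T R) x < 1 /\ irrational (iter n (@sengel_T R) x).
  elim: n => //= n [y01 yirr].
  by have [k [dk _ ->]] := sengel_digit y01 yirr; exact: has_digit_norm.
have ex n : exists k, [/\ has_digit k (iter n (@sengel_T R) x),
      sengel_d n.+1 x = k.*2%:R &
      iter n.+1 (@sengel_T R) x = `|k.*2%:R * iter n (@sengel_T R) x - 1| ].
  by have [y01 yirr] := orb n; exact: sengel_digit.
by exists (fun n => projT1 (cid (ex n))) => n; exact: (projT2 (cid (ex n))).
Qed.

Section OrbitDigits.
Variables (kappa : nat -> nat) (x : R).
Hypothesis kx : orbit_digits kappa x.

Lemma kappa_gt0 n : (0 < kappa n)%N. Proof. by have [[]] := kx n. Qed.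

Lemma sengel_R1 : sengel_R 1 x = (kappa 0).*2%:R.
Proof. by rewrite /sengel_R/=; have [_ ->] := kx 0. Qed.

Lemma sengel_RS n : sengel_R n.+2 x = (kappa n.+1)%:R / (kappa n)%:R.
Proof.
rewrite /sengel_R/=; have [_ -> _] := kx n.+1; have [_ -> _] := kx n.
by rewrite -!mul2n !natrM invfM mulrACA divff ?mul1r// pnatr_eq0.
Qed.

End OrbitDigits.

(* The value 1 at 0 makes R_1 = 2 kappa_0 twice the ratio of index 0. *)
Definition prev_digit (kappa : nat -> nat) n := if n is n'.+1 then kappa n' else 1%N.

Lemma small_ratiosP t n kappa x : orbit_digits kappa x ->
  (forall i, (i < n)%N -> (kappa i <= t * prev_digit kappa i)%N) ->
  small_ratios t n 1 x.
Proof.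
move=> kx H.
(* Generalising over the starting time i lets the induction on the remaining length j move along the
   orbit. *)
suff S i : forall j, (i + j = n)%N -> small_ratios t j (prev_digit kappa i) (iter i (@sengel_T R) x).
  exact: (S 0%N n).
move=> j; elim: j i => //= j IH i ijn.
have [dk _ yE] := kx i; exists (kappa i); split => //.
  by apply: H; rewrite -ijn; lia.
by rewrite -yE; apply: (IH i.+1); rewrite -ijn addSnnS.
Qed.

Lemma large_ratioP t n kappa x : orbit_digits kappa x ->
  (t * prev_digit kappa n < kappa n)%N -> large_ratio t n 1 x.
Proof.
move=> kx H.
suff S j : forall i, (i + j = n)%N -> large_ratio t j (prev_digit kappa i) (iter i (@sengel_T R) x).
  exact: (S n 0%N).
elim: j => [|j IH] i ijn /=.
  by rewrite addn0 in ijn; rewrite ijn; exists (kappa n); have [] := kx n.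
(* The actual half-digit serves as its own cutoff. *)
have [dk _ yE] := kx i; exists (kappa i), (kappa i); split => //.
by rewrite -yE; apply: (IH i.+1); rewrite -ijn addSnnS.
Qed.

End Orbits.

(** * Borel-Cantelli for covered sets *)

Section BorelCantelli.
Variable R : realType.
Local Open Scope classical_set_scope.
Notation mu := (@lebesgue_measure R).

Lemma covered_measurable (A : set R) r : covered A r ->
  exists U, [/\ measurable U, A `<=` U & (mu U <= r%:E)%E].
Proof.
move=> [s [sA sle sr]].
pose U s : set R := [set x | has (fun p => p.1 < x < p.2) s].
suff [mU muU] : measurable (U s) /\ (mu (U s) <= (\sum_(p <- s) (p.2 - p.1))%:E)%E.
  by exists (U s); split => //; apply: (le_trans muU); rewrite lee_fin.
elim: s sle {sA sr} => [_|[a b] s IH /= /andP[ab /IH[mU muU]]].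
  by rewrite (_ : U _ = set0) ?measure0 ?big_nil//; apply/seteqP; split.
rewrite (_ : U _ = `]a, b[ `|` U s); last first.
  by apply/seteqP; split => x /=; rewrite in_itv/= => /orP.
split; first exact: measurableU.
rewrite big_cons EFinD; apply: (le_trans (measureU2 _ _ _)) => //.
apply: leeD => //.
rewrite [leLHS]lebesgue_measure_itv/= lte_fin.
by case: ltP => //; rewrite lee_fin subr_ge0.
Qed.

(** The negligible set is the upper limit of open hulls [U j] of the [A j], whose measures have
    partial sums at most [C]. *)
Lemma ae_eventually_not (A : nat -> set R) (r : nat -> R) (C : R) :
  (forall j, covered (A j) (r j)) -> (forall n, \sum_(j < n) r j <= C) ->
  {ae mu, forall x, exists N, forall j, (N <= j)%N -> ~ A j x}.
Proof.
move=> cA rC.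
have U_ j : {U | [/\ measurable U, A j `<=` U & (mu U <= (r j)%:E)%E]}.
  exact/cid/covered_measurable.
pose U j := projT1 (U_ j).
have mU j : measurable (U j) by rewrite /U; case: (U_ j) => /= ? [].
have AU j : A j `<=` U j by rewrite /U; case: (U_ j) => /= ? [].
have muU j : (mu (U j) <= (r j)%:E)%E by rewrite /U; case: (U_ j) => /= ? [].
exists (lim_sup_set U); split.
- by apply: bigcap_measurable => // n _; apply: bigcup_measurable => j _; exact: mU.
- apply: lim_sup_set_cvg0 => //; apply: (@le_lt_trans _ _ C%:E); last exact: ltry.
  apply: lime_le; first by apply: is_cvg_nneseries => j _ _; exact: measure_ge0.
  apply: nearW => n; rewrite big_mkord.
  apply: (@le_trans _ _ (\sum_(j < n) (r j)%:E)%E); first by apply: lee_sum => j _; exact: muU.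
  by rewrite sumEFin lee_fin.
- move=> x /= H n _; apply: contrapT => nU; apply: H; exists n => j nj Ax.
  by apply: nU; exists j => //; exact: AU.
Qed.

End BorelCantelli.

(** * Criteria for bounding a lower limit *)

Section LiminfBounds.
Variable R : realType.
Implicit Types (u : nat -> \bar R) (a : \bar R).

Lemma limn_einf_le u a : (forall N, exists2 n, (N <= n)%N & (u n <= a)%E) ->
  (limn_einf u <= a)%E.
Proof.
move=> H; rewrite limn_einf_lim; apply: lime_le; first exact: is_cvg_einfs.
apply: nearW => N; have [n Nn una] := H N.
by apply: le_trans una; apply: ereal_inf_lbound; exists n.
Qed.

Lemma limn_einf_ge u a N : (forall n, (N <= n)%N -> (a <= u n)%E) ->
  (a <= limn_einf u)%E.
Proof.
move=> H; rewrite limn_einf_lim; apply: lime_ge; first exact: is_cvg_einfs.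
near=> M; apply: le_ereal_inf_tmp => _ [n /= Mn <-]; apply: H; apply: leq_trans Mn.
by near: M; exists N.
Unshelve. all: by end_near. Qed.

End LiminfBounds.

(** * Logarithmic estimates along [sparse] and between consecutive [window] values *)

Section LogLog.
Variable R : realType.
Implicit Types (u M : nat -> R) (j n N : nat) (a e : R).

(** The inner exponent j^2 makes log log n outgrow j log 2, the logarithm of the error factor
    2^j. *)
Definition sparse j := (2 ^ (2 ^ (j ^ 2)))%N.

(** There are 2(l+1) blocks of 2^(j+1) ratios, with 2^(l+1) > j+1. Each block at least halves the
    bound on the length, which ends up at most (j+1)^-2, a summable sequence. *)
Definition window j := (2 ^ j * 2 * (2 * (trunc_log 2 j.+1).+1))%N.

Let l2 : R := ln 2.

Let l2_ge : 2^-1 <= l2.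
Proof.
have : ln (1 + (- 2^-1)) <= - 2^-1 :> R by apply: le_ln1Dx; lra.
have -> : 1 + (- 2^-1) = 2^-1 :> R by lra.
by rewrite lnV ?posrE// /l2; lra.
Qed.

Let l2_le1 : l2 <= 1.
Proof. by rewrite /l2; have := @le_ln1Dx R 1 ltac:(lra). Qed.

Let lnl2 : - l2 <= ln l2 <= 0.
Proof.
rewrite ln_le0// andbT /l2 -lnV ?posrE// ler_ln ?posrE ?invr_gt0//.
by apply: lt_le_trans l2_ge; rewrite invr_gt0.
Qed.

Lemma ln_exp2 n : ln (2 ^ n)%N%:R = n%:R * l2 :> R.
Proof. by rewrite natrX lnXn// mulr_natl. Qed.

Lemma ln_sparse j : ln (sparse j)%:R = (2 ^ (j ^ 2))%N%:R * l2 :> R.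
Proof. exact: ln_exp2. Qed.

(** The middle term is j^2 ln 2 + ln(ln 2), and ln 2 lies between 1/2 and 1. *)
Lemma lnln_sparse j : (j%:R ^+ 2 - 1) * l2 <= ln (ln (sparse j)%:R) <= j%:R ^+ 2 * l2.
Proof.
have l0 : 0 < l2 by apply: lt_le_trans l2_ge; rewrite invr_gt0.
rewrite ln_sparse lnM ?posrE ?ltr0n ?expn_gt0// ln_exp2 natrX; have := lnl2; lra.
Qed.

Lemma leq_sparse j : (j <= sparse j)%N.
Proof.
have h n : (n <= 2 ^ n)%N by exact/ltnW/ltn_expl.
apply: leq_trans (h (2 ^ (j ^ 2))%N); apply: leq_trans (h (j ^ 2)%N).
by rewrite -mulnn; case: j => // j; rewrite leq_pmulr.
Qed.

Lemma leq_sqr_exp2 m : (4 <= m)%N -> (m ^ 2 <= 2 ^ m)%N.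
Proof.
move=> /subnK <-; elim: (m - 4)%N => // i IH.
rewrite addSn [leqRHS]expnS; apply: (@leq_trans (2 * (i + 4) ^ 2)); last by rewrite leq_mul2l.
by rewrite -!mulnn; clear; nia.
Qed.

Lemma truncnS_le (a : R) n : ((Num.truncn a).+1 <= n)%N -> a <= n%:R.
Proof. by move=> h; apply: (le_trans (ltW (truncnS_gt a))); rewrite ler_nat. Qed.

(** At n = [sparse j] the numerator is at most (j - 2^(j^2)) ln 2 <= (j - j^4) ln 2, while the
    denominator is at most j^2 ln 2. For j >= a+1 the quotient is therefore at most -a. *)
Lemma limn_einf_Ny u N : (forall j, (N <= j)%N -> 0 < u (sparse j) <= (2 ^ j)%N%:R) ->
  limn_einf (fun n => ((ln (u n) - ln n%:R) / ln (ln n%:R))%:E) = -oo%E.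
Proof.
move=> uN.
suff H a : 0 <= a -> (limn_einf (fun n => ((ln (u n) - ln n%:R) / ln (ln n%:R))%:E) <= (- a)%:E)%E.
  case: (limn_einf _) H => [r|H|//].
  - move/(_ (`|r| + 1)); rewrite lee_fin => H.
    have := ler_norm (- r); rewrite normrN => h; exfalso.
    by have := H (addr_ge0 (normr_ge0 _) ler01); lra.
  - by have := H 0 (lexx _); rewrite leNgt ltry.
move=> a0; apply: limn_einf_le => K.
pose j := (N + K + 2 + (Num.truncn (a + 1)).+1)%N.
have jN : (N <= j)%N by rewrite /j; lia.
have jK : (K <= j)%N by rewrite /j; lia.
have j2 : (2 <= j)%N by rewrite /j; lia.
have aj : a + 1 <= j%:R by apply: truncnS_le; rewrite /j; lia.
clearbody j; exists (sparse j); first exact: leq_trans (leq_sparse j).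
rewrite lee_fin.
have /andP[Dl Du] := lnln_sparse j.
have l0 : 0 < l2 by apply: lt_le_trans l2_ge; rewrite invr_gt0.
have jR : 2 <= j%:R :> R by rewrite ler_nat.
have D0 : 0 < ln (ln (sparse j)%:R) :> R by apply: lt_le_trans Dl; rewrite mulr_gt0//; nra.
rewrite ler_pdivrMr//.
have /andP[u0 uj] := uN j jN.
have lu : ln (u (sparse j)) <= j%:R * l2 by rewrite -ln_exp2 ler_ln ?posrE ?ltr0n ?expn_gt0.
have sq : j%:R ^+ 2 * j%:R ^+ 2 <= (2 ^ (j ^ 2))%N%:R :> R.
  by rewrite -!natrX -natrM ler_nat mulnn; apply: leq_sqr_exp2; by rewrite -[4%N]/(2 ^ 2)%N leq_exp2r.
set D := ln (ln _) in Dl Du D0 *.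
rewrite ln_sparse; set E := (2 ^ (j ^ 2))%N%:R in sq *.
apply: (@le_trans _ _ ((j%:R - E) * l2)); first by rewrite mulrBl lerB.
apply: (@le_trans _ _ (- a * j%:R ^+ 2 * l2)); last by rewrite -mulrA !mulNr lerN2 ler_wpM2l.
apply: ler_wpM2r; first exact: ltW.
have jm : j%:R <= j%:R ^+ 2 :> R by rewrite expr2; nra.
have : j%:R ^+ 2 * (a + 1) <= j%:R ^+ 2 * j%:R ^+ 2 :> R.
  by apply: ler_wpM2l; [exact: sqr_ge0 | exact: le_trans jm].
lra.
Qed.

(** At n = [sparse j] the numerator is at most (j+1) ln 2 and the denominator at least (j-1)(j+1) ln
    2, so the quotient is at most 1/(j-1); hence the choice j >= 1 + 1/e. *)
Lemma limn_einf_le0 M N :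
  (forall j, (N <= j)%N -> 0 < M (sparse j) <= 2 * ((sparse j)%:R * (2 ^ j)%N%:R)) ->
  (limn_einf (fun n => ((ln (M n) - ln n%:R) / ln (ln n%:R))%:E) <= 0)%E.
Proof.
move=> MN; apply/lee_addgt0Pr => e e0; rewrite add0e; apply: limn_einf_le => K.
pose j := (N + K + 2 + (Num.truncn (1 + e^-1)).+1)%N.
have jN : (N <= j)%N by rewrite /j; lia.
have jK : (K <= j)%N by rewrite /j; lia.
have j2 : (2 <= j)%N by rewrite /j; lia.
have ej : 1 + e^-1 <= j%:R by apply: truncnS_le; rewrite /j; lia.
clearbody j; exists (sparse j); first exact: leq_trans (leq_sparse j).
rewrite lee_fin.
have /andP[Dl Du] := lnln_sparse j.
have l0 : 0 < l2 by apply: lt_le_trans l2_ge; rewrite invr_gt0.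
have jR : 2 <= j%:R :> R by rewrite ler_nat.
have D0 : 0 < ln (ln (sparse j)%:R) :> R by apply: lt_le_trans Dl; rewrite mulr_gt0//; nra.
rewrite ler_pdivrMr//.
have /andP[M0 Mj] := MN j jN.
have p0 : 0 < (sparse j)%:R :> R by rewrite ltr0n expn_gt0.
have q0 : 0 < (2 ^ j)%N%:R :> R by rewrite ltr0n expn_gt0.
have lM : ln (M (sparse j)) <= l2 + (ln (sparse j)%:R + j%:R * l2).
  by rewrite -ln_exp2 -!lnM ?posrE ?mulr_gt0// ler_ln ?posrE ?mulr_gt0.
apply: (@le_trans _ _ ((j%:R + 1) * l2)); first by rewrite mulrDl mul1r; lra.
apply: (@le_trans _ _ (e * ((j%:R ^+ 2 - 1) * l2))); last by rewrite ler_wpM2l// ltW.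
rewrite mulrA; apply: ler_wpM2r; first exact: ltW.
have {}ej : 1 <= e * (j%:R - 1) by rewrite -ler_pdivrMl// mulr1; lra.
have -> : j%:R ^+ 2 - 1 = (j%:R - 1) * (j%:R + 1) :> R by ring.
by rewrite mulrA ler_peMl//; lra.
Qed.

(** Since j <= [window j], only finitely many j have [window j] <= n, and the largest is taken. This
    passes from the scale j to every large n. *)
Lemma window_bracket J n : (window J <= n)%N ->
  exists2 j, (J <= j)%N & (window j <= n < window j.+1)%N.
Proof.
move=> Jn.
have wj j : (j <= window j)%N.
  apply: (leq_trans (ltnW (ltn_expl j (ltnSn 1)))).
  by rewrite /window -mulnA leq_pmulr// muln_gt0.
have ex : exists j, (window j <= n)%N by exists J.
have ub j : (window j <= n)%N -> (j <= n)%N by apply: leq_trans.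
case: (ex_maxnP ex ub) => j jn jmax; exists j; first exact: jmax.
by rewrite jn ltnNge; apply/negP => /jmax; rewrite ltnn.
Qed.

Lemma limn_einf_ge0 M N :
  (forall j n, (N <= j)%N -> (window j <= n)%N -> (2 ^ j)%N%:R <= M n) ->
  (0 <= limn_einf (fun n => ((ln (M n) - ln n%:R) / ln (ln n%:R))%:E))%E.
Proof.
move=> MN; apply/lee_addgt0Pr => e e0.
rewrite -leeBlDr// sub0e -EFinN.
(* With i the integer part of log2(j+2), the deficit ln n - ln M_n is at most 3 ln 2 + ln(i+1), and
   log log n >= (i-2) ln 2. Using 1/2 <= ln 2 <= 1 and ln(i+1) <= (e/4)(i+1) - ln(e/4), the deficit
   is at most e log log n once i(e/4) >= 3 + 5e/4 - ln(e/4). *)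
pose I := (3 + (Num.truncn ((3 + 5 * e / 4 - ln (e / 4)) / (e / 4))).+1)%N.
apply: (@limn_einf_ge _ _ _ (window (N + 2 ^ I))) => n.
move=> /window_bracket[j Jj /andP[jn nj]]; rewrite lee_fin.
have Mj := MN j n (leq_trans (leq_addr _ _) Jj) jn.
have l0 : 0 < l2 by apply: lt_le_trans l2_ge; rewrite invr_gt0.
pose i := trunc_log 2 j.+2.
have Ii : (I <= i)%N by apply: trunc_log_max => //; lia.
have ij : (2 ^ i <= j.+2)%N by exact: trunc_logP.
have I3 : (3 <= I)%N by rewrite /I; lia.
have Ie : (3 + 5 * e / 4 - ln (e / 4)) / (e / 4) <= I%:R by apply: truncnS_le; rewrite /I; lia.
clearbody I.
have iI : I%:R <= i%:R :> R by rewrite ler_nat.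
have i3 : (3 <= i)%N by exact: leq_trans Ii.
have i3R : 3 <= i%:R :> R by rewrite ler_nat.
have ij' : (2 ^ i.-1 <= j)%N.
  have : (2 ^ i.-1 * 2 <= j.+2)%N by rewrite -expnSr prednK//; lia.
  have : (2 ^ 2 <= 2 ^ i.-1)%N by rewrite leq_exp2l//; lia.
  by clear; lia.
have wE : window j.+1 = (2 ^ j.+3 * i.+1)%N.
  by rewrite /window -/i mulnA -!expnSr.
have n0 : 0 < n%:R :> R.
  by rewrite ltr0n; apply: leq_trans jn; rewrite /window !muln_gt0 expn_gt0.
have w0 : 0 < (window j.+1)%:R :> R by rewrite ltr0n wE muln_gt0 expn_gt0.
have lnn : ln n%:R <= (j%:R + 3) * l2 + ln i.+1%:R.
  rewrite -[3]/(3%:R) -natrD addn3 -ln_exp2 -lnM ?posrE ?ltr0n ?expn_gt0// -natrM -wE.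
  by rewrite ler_ln ?posrE// ler_nat ltnW.
have lnMn : j%:R * l2 <= ln (M n).
  have q0 : 0 < (2 ^ j)%N%:R :> R by rewrite ltr0n expn_gt0.
  by rewrite -ln_exp2 ler_ln ?posrE// (lt_le_trans q0).
have D1 : j%:R * l2 <= ln n%:R.
  have q0 : 0 < (2 ^ j)%N%:R :> R by rewrite ltr0n expn_gt0.
  rewrite -ln_exp2 ler_ln ?posrE// ler_nat.
  by apply: leq_trans jn; rewrite /window -mulnA leq_pmulr// muln_gt0.
have j0 : (0 < j)%N by apply: leq_trans ij'; rewrite expn_gt0.
have jl0 : 0 < j%:R * l2 by rewrite mulr_gt0 ?ltr0n.
have lnj : (i%:R - 1) * l2 <= ln j%:R.
  have -> : i%:R - 1 = i.-1%:R :> R.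
    by rewrite -[in LHS](@prednK i) -1?natr1 ?addrK// (leq_trans _ i3).
  rewrite -ln_exp2.
  by rewrite ler_ln ?posrE ?ltr0n ?expn_gt0 ?ler_nat.
have D2 : (i%:R - 2) * l2 <= ln (ln n%:R).
  apply: (@le_trans _ _ (ln (j%:R * l2))); last first.
    by rewrite ler_ln ?posrE//; exact: lt_le_trans D1.
  by rewrite lnM ?posrE ?ltr0n//; have := lnl2; lra.
have D0 : 0 < ln (ln n%:R) :> R by apply: lt_le_trans D2; rewrite mulr_gt0//; lra.
rewrite ler_pdivlMr//.
have li : ln i.+1%:R <= e / 4 * (i%:R + 1) - ln (e / 4).
  have e4 : 0 < e / 4 by rewrite divr_gt0.
  have := @ln_sublinear R (e / 4 * i.+1%:R) (mulr_gt0 e4 (ltr0Sn R i)).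
  by rewrite lnM ?posrE// -natr1; lra.
have D3 : e * ((i%:R - 2) * l2) <= e * ln (ln n%:R) by rewrite ler_wpM2l// ltW.
move: Ie; rewrite ler_pdivrMr ?divr_gt0// => Ie.
have ei : e * I%:R <= e * i%:R by rewrite ler_wpM2l// ltW.
have el : e * (i%:R - 2) * 2^-1 <= e * (i%:R - 2) * l2.
  by rewrite ler_wpM2l// mulr_ge0 ?ltW//; lra.
by have := l2_le1; lra.
Qed.

End LogLog.

(** * The three almost sure events *)

Section Events.
Variable R : realType.

(** The base is the inverse of 1 + 1/c, and Bernoulli's inequality (1 + 1/c)^n >= 1 + n/c gives 2 at
    n = c. *)
Lemma expr_pred_ratio_le_half (c : nat) : (0 < c)%N -> (1 - c.+1%:R^-1) ^+ c <= 2^-1 :> R.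
Proof.
move=> c0; have cR : 0 < c%:R :> R by rewrite ltr0n.
have qE : 1 - c.+1%:R^-1 = c%:R / (c%:R + 1) :> R.
  by rewrite -natr1; field; rewrite gt_eqF// addr_gt0.
suff H n : (1 - c.+1%:R^-1) ^+ n * (1 + n%:R / c%:R) <= 1 :> R.
  by have := H c; rewrite divff ?gt_eqF//; lra.
elim: n => [|n IH]; first by rewrite expr0 mul0r addr0 mulr1.
apply: le_trans IH; rewrite exprSr -mulrA; apply: ler_wpM2l.
  by apply: exprn_ge0; rewrite qE divr_ge0// addr_ge0.
rewrite qE -natr1 -(ler_pM2r cR) -(ler_pM2r (addr_gt0 cR ltr01)).
have -> : c%:R / (c%:R + 1) * (1 + (n%:R + 1) / c%:R) * c%:R * (c%:R + 1) =
   c%:R * (c%:R + n%:R + 1) :> R by field; rewrite !gt_eqF// addr_gt0.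
have -> : (1 + n%:R / c%:R) * c%:R * (c%:R + 1) = (c%:R + n%:R) * (c%:R + 1) :> R.
  by field; rewrite gt_eqF.
have : 0 <= n%:R :> R by []; lra.
Qed.

(** The choice k = m = 1 gives the whole of (0, 1), and 2/t lies strictly above 3/(2t). *)
Lemma covered_large_ratio t n : (0 < t)%N ->
  covered (fun x : R => large_ratio t n 1 x /\ 0 < x < 1) (2 / t%:R).
Proof.
move=> t0; have tR : 0 < t%:R :> R by rewrite ltr0n.
have td : 3 / t.*2%:R < 2 / t%:R :> R.
  rewrite -muln2 natrM ltr_pdivrMr ?mulr_gt0// mulrA divfK ?gt_eqF//; lra.
have := uniform_large_ratio n t0 td (ltn0Sn 0) (or_introl erefl : 1%N = 1.*2.-1 \/ _).
by rewrite invr1 mulr1.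
Qed.

Lemma covered_small_ratios j :
  covered (fun x : R => small_ratios (2 ^ j) (window j) 1 x /\ 0 < x < 1) (j.+1%:R ^- 2).
Proof.
have t0 : (0 < 2 ^ j)%N by rewrite expn_gt0.
have := @uniform_small_ratios R _ (window j) t0 1%N 1%N (ltn0Sn 0) (or_introl erefl).
rewrite invr1 mulr1; apply: covered_le => //.
have t2 : (0 < (2 ^ j).*2)%N by rewrite double_gt0.
rewrite /window -mulnA mulnCA mulnA mul2n exprM.
set l := trunc_log 2 j.+1.
have h0 : 0 <= (1 - (2 ^ j).*2.+1%:R^-1) ^+ (2 ^ j).*2 :> R.
  by apply: exprn_ge0; rewrite subr_ge0 invf_le1 ?ler1n.
apply: (le_trans (lerXn2r _ _ _ (expr_pred_ratio_le_half t2))); rewrite ?nnegrE ?invr_ge0//.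
rewrite exprVn lef_pV2 ?posrE ?exprn_gt0// mulnC exprM lerXn2r ?nnegrE ?exprn_ge0//.
by rewrite -natrX ler_nat; apply/ltnW/trunc_log_ltn.
Qed.

Lemma sum_half_pow_le n : \sum_(j < n) 2 / (2 ^ j)%N%:R <= 4 :> R.
Proof.
suff -> : \sum_(j < n) 2 / (2 ^ j)%N%:R = 4 - 4 / (2 ^ n)%N%:R :> R.
  by rewrite gerBl divr_ge0.
elim: n => [|n IH]; first by rewrite big_ord0 expn0; lra.
by rewrite big_ord_recr/= IH expnS natrM invfM; lra.
Qed.

Lemma sum_inv_sqr_le n : \sum_(j < n) j.+1%:R ^- 2 <= 2 :> R.
Proof.
(* The terms are at most 2/((j+1)(j+2)), which telescopes. *)
suff H : \sum_(j < n) j.+1%:R ^- 2 <= 2 - 2 / n.+1%:R :> R.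
  by apply: (le_trans H); rewrite gerBl divr_ge0.
elim: n => [|n IH]; first by rewrite big_ord0; lra.
rewrite big_ord_recr/=; apply: le_trans (lerD IH (lexx _)) _.
have : 0 <= n%:R :> R by [].
rewrite -[n.+2%:R]natr1 -[n.+1%:R]natr1; move: (n%:R) => y y0.
rewrite -subr_ge0 (_ : _ - _ = y / ((y + 1) ^+ 2 * (y + 1 + 1))).
  by rewrite divr_ge0// mulr_ge0// ?sqr_ge0//; lra.
by field; apply/andP; split; rewrite gt_eqF//; lra.
Qed.

#[local] Instance ae_lebesgue_filter :
  Filter (nbhs (almost_everywhere (@lebesgue_measure R))).
Proof. exact: ae_filter_ringOfSetsType. Qed.

(** Ratios are counted from 0, so the index [(sparse j).-1] concerns R_n with n = [sparse j]. *)
Lemma ae_eventually_large_ratio :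
  {ae @lebesgue_measure R, forall x, 0 < x < 1 -> exists N, forall j, (N <= j)%N ->
     ~ large_ratio (2 ^ j) (sparse j).-1 1 x}.
Proof.
have t0 j : (0 < 2 ^ j)%N by rewrite expn_gt0.
have := @ae_eventually_not R _ _ 4
  (fun j => covered_large_ratio (sparse j).-1 (t0 j)) sum_half_pow_le.
apply: filterS => x [N H] x01; exists N => j Nj L; exact: (H j Nj).
Qed.

(** Union bound: [sparse j] events of length 2/([sparse j] 2^j) each, in total 2/2^j. *)
Lemma ae_eventually_all_ratios :
  {ae @lebesgue_measure R, forall x, 0 < x < 1 -> exists N, forall j, (N <= j)%N ->
     forall i, (i < sparse j)%N -> ~ large_ratio (sparse j * 2 ^ j) i 1 x}.
Proof.
have s0 j : (0 < sparse j)%N by rewrite expn_gt0.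
have t0 j : (0 < sparse j * 2 ^ j)%N by rewrite muln_gt0 s0 expn_gt0.
have c j : covered (fun x : R => exists2 i, (i < sparse j)%N &
    large_ratio (sparse j * 2 ^ j) i 1 x /\ 0 < x < 1) (2 / (2 ^ j)%N%:R).
  have := @covered_bigU R (sparse j) _ _ (fun i _ => covered_large_ratio i (t0 j)).
  rewrite -[X in covered _ X]mulr_natl natrM invfM (mulrCA 2) mulVKf// pnatr_eq0 -lt0n; exact: s0.
have := @ae_eventually_not R _ _ 4 c sum_half_pow_le.
apply: filterS => x [N H] x01; exists N => j Nj i ij L; apply: (H j Nj).
by exists i.
Qed.

Lemma ae_eventually_not_small_ratios :
  {ae @lebesgue_measure R, forall x, 0 < x < 1 -> exists N, forall j, (N <= j)%N ->
     ~ small_ratios (2 ^ j) (window j) 1 x}.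
Proof.
have := @ae_eventually_not R _ _ 2 covered_small_ratios sum_inv_sqr_le.
by apply: filterS => x [N H] x01; exists N => j Nj L; exact: (H j Nj).
Qed.

End Events.

(** * From the events to bounds on R_n and M_n *)

Section Conclusion.
Variables (R : realType) (kappa : nat -> nat) (x : R).
Hypothesis kx : orbit_digits kappa x.

Let k0 i : 0 < (kappa i)%:R :> R.
Proof. by rewrite ltr0n (kappa_gt0 kx). Qed.

Lemma sengel_R_gt0 n : 0 < sengel_R n x.
Proof.
case: n => [|[|n]]; last by rewrite (sengel_RS kx) divr_gt0.
  by rewrite -[sengel_R 0 x]/(sengel_R 1 x) (sengel_R1 kx) ltr0n double_gt0 (kappa_gt0 kx).
by rewrite (sengel_R1 kx) ltr0n double_gt0 (kappa_gt0 kx).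
Qed.

Lemma sengel_RS_le t n : ~ large_ratio t n.+1 1 x -> sengel_R n.+2 x <= t%:R.
Proof.
move=> nL; rewrite (sengel_RS kx) ler_pdivrMr// -natrM ler_nat leqNgt.
by apply/negP => L; apply: nL; exact: (large_ratioP kx).
Qed.

Lemma sengel_R_le t n : ~ large_ratio t n 1 x -> sengel_R n.+1 x <= 2 * t%:R.
Proof.
case: n => [nL|n /sengel_RS_le h]; last by apply: (le_trans h); have : 0 <= t%:R :> R by []; lra.
rewrite (sengel_R1 kx) -natrM ler_nat -mul2n leq_mul2l/= leqNgt.
by apply/negP => L; apply: nL; apply: (large_ratioP kx); rewrite muln1.
Qed.

Lemma sengel_M_gt0 n : 0 < sengel_M n x.
Proof. by apply: lt_le_trans (sengel_R_gt0 1) _; exact: bigmax_ge_id. Qed.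

Lemma sengel_M_le t n : (0 < n)%N -> (forall i, (i < n)%N -> ~ large_ratio t i 1 x) ->
  sengel_M n x <= 2 * t%:R.
Proof.
move=> n0 nL; rewrite /sengel_M big_nat; apply: bigmax_le.
  exact/sengel_R_le/nL.
by move=> [//|i] /= ni; apply/sengel_R_le/nL.
Qed.

Lemma sengel_M_ge t n m : (n <= m)%N -> ~ small_ratios t n 1 x -> t%:R <= sengel_M m x.
Proof.
move=> nm nS.
have [i [ni ki]] : exists i, (i < n)%N /\ (t * prev_digit kappa i < kappa i)%N.
  apply: contrapT => H; apply: nS; apply: (small_ratiosP kx) => i ni.
  by rewrite leqNgt; apply/negP => ki; apply: H; exists i.
apply: (@bigmax_sup_seq _ _ _ _ _ i.+1) => //.
  by rewrite mem_index_iota/= ltnS (leq_trans ni).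
case: i ni ki => [|i] ni /=.
  (* For R_1 = 2 kappa_0 the factor 2 only helps the lower bound. *)
  rewrite (sengel_R1 kx) ler_nat muln1 => /ltnW h.
  by apply: (leq_trans h); rewrite -addnn leq_addl.
by rewrite (sengel_RS kx) ler_pdivlMr// -natrM ler_nat => /ltnW.
Qed.

End Conclusion.

Unset Implicit Arguments.

Theorem theorem1p8 (R : realType) :
  {ae (@lebesgue_measure R), forall x : R,
    0 < x < 1 -> x \in irrational ->
    limn_einf (fun n : nat =>
       ((ln (sengel_R n x) - ln n%:R) / ln (ln n%:R))%:E) = -oo%E /\
    limn_einf (fun n : nat =>
       ((ln (sengel_M n x) - ln n%:R) / ln (ln n%:R))%:E) = 0%E}.
Proof.
have aeF := @ae_lebesgue_filter R.
have := ae_eventually_not_small_ratios R; have := ae_eventually_all_ratios R.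
have := ae_eventually_large_ratio R; apply: filterS3.
move=> x H1 H2 H3 x01 /[!inE] xirr.
have [N1 {}H1] := H1 x01; have [N2 {}H2] := H2 x01; have [N3 {}H3] := H3 x01.
have [kappa kx] := orbit_digits_exists x01 xirr.
have s0 j : (0 < sparse j)%N by rewrite expn_gt0.
split.
  apply: (@limn_einf_Ny _ _ N1) => j Nj.
  rewrite (sengel_R_gt0 kx)/=.
  (* This avoids R_1, the only ratio whose upper bound carries a factor 2. *)
  have : (2 <= sparse j)%N.
    by rewrite /sparse -[2%N]/(2 ^ 1)%N leq_exp2l// expn_gt0.
  move: (H1 j Nj); case: (sparse j) => [|[|n]]//= nL _.
  exact: (sengel_RS_le kx).
apply/eqP; rewrite eq_le; apply/andP; split.
  apply: (@limn_einf_le0 _ _ N2) => j Nj.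
  rewrite (sengel_M_gt0 kx)/= -natrM; apply: (sengel_M_le kx) => //.
  exact: H2.
by apply: (@limn_einf_ge0 _ _ N3) => j n Nj wn; apply: (sengel_M_ge kx wn); exact: H3.
Qed.
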